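(* Let $L$ be a loop, $G$ a middle and right nuclear normal subgroup of $L$, let $K\times_f^{\Theta}G$ be a Schreier decomposition of $L$ with underlying isomorphism $\kappa:K\to L/G$, and let $\mu$ be an automorphism of $K$. If the functions $\widetilde\Theta:K\to\mathrm{Aut}(G)$ and $\tilde f:K\times K\to G$ are given by $$\widetilde\Theta_\tau=\Theta_{\mu(\tau)},\qquad\tilde f(\sigma,\tau)=f(\mu(\sigma),\mu(\tau)),\qquad\sigma,\tau\in K,$$ then the Schreier extension $K\times_{\tilde f}^{\widetilde\Theta}G$ is a Schreier decomposition of $L$ with underlying isomorphism $\kappa\circ\mu:K\to L/G$.
   Context: A subgroup $G$ of a loop $L$ is middle (right) nuclear if it is contained in the middle nucleus $\{u: xu\cdot y=x\cdot uy\ \forall x,y\in L\}$ (right nucleus $\{u: xy\cdot u=x\cdot yu\ \forall x,y\in L\}$). Let $K$ be a loop with identity $\epsilon$ and $e$ the identity of $G$. For maps $f:K\times K\to G$ and $\Theta:K\to\mathrm{Aut}(G)$ with $f(\sigma,\epsilon)=f(\epsilon,\sigma)=e$ and $\Theta_\epsilon=\mathrm{Id}$, the Schreier extension $K\times_f^{\Theta}G$ is the loop on $K\times G$ with multiplication $(\sigma,s)(\tau,t)=(\sigma\tau,f(\sigma,\tau)\Theta_\tau(s)t)$. It is a Schreier decomposition of $L$ (with respect to $G$) with underlying isomorphism $\kappa:K\to L/G$ if there is an isomorphism $\mathcal{F}:K\times_f^{\Theta}G\to L$ with $\mathcal{F}(\epsilon,t)=t$ for all $t\in G$ and $\mathcal{F}(\sigma,e)G=\kappa(\sigma)$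 for all $\sigma\in K$. *)

(* Defs.v *)
From HB Require Import structures.
From mathcomp Require Import all_boot boolp classical_sets.

Set Implicit Arguments.
Unset Strict Implicit.
Unset Printing Implicit Defensive.

Local Open Scope classical_set_scope.
Local Open Scope group_scope.

(* [ldiv a b] is the unique solution y of a * y = b and [rdiv b a] the unique
   solution x of x * a = b. The carrier is an arbitrary type: no choice
   structure is required, and K, L may be infinite. *)
HB.mixin Record BaseUMagma_isLoop L of BaseUMagma L := {
  ldiv : L -> L -> L;
  rdiv : L -> L -> L;
  loop_mul1 : left_id (1 : L) mul;
  loop_mulr1 : right_id (1 : L) mul;
  mul_ldiv : forall a b : L, a * ldiv a b = b;
  ldiv_mul : forall a y : L, ldiv a (a * y) = y;
  rdiv_mul : forall a b : L, rdiv b a * a = b;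
  mul_rdiv : forall a x : L, rdiv (x * a) a = x
}.

#[short(type="loopType")]
HB.structure Definition Loop := {L of BaseUMagma L & BaseUMagma_isLoop L}.

Lemma loop_mulI (L : loopType) (a : L) : injective (mul a).
Proof. by move=> x y E; rewrite -(ldiv_mul a x) E ldiv_mul. Qed.

Lemma loop_mulIr (L : loopType) (a : L) : injective (fun x : L => x * a).
Proof. by move=> x y /= E; rewrite -(mul_rdiv a x) E mul_rdiv. Qed.

Record iso (M N : magmaType) := Iso {
  iso_fun :> M -> N;
  isoM : {morph iso_fun : x y / x * y};
  iso_bij : bijective iso_fun
}.

Definition aut (M : magmaType) := iso M M.

Lemma iso_comp_morph (M N P : magmaType) (g : iso N P) (h : iso M N) :
  {morph g \o h : x y / x * y}.
Proof. by move=> x y /=; rewrite !isoM. Qed.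

Definition iso_comp (M N P : magmaType) (g : iso N P) (h : iso M N) : iso M P :=
  Iso (iso_comp_morph g h) (bij_comp (iso_bij g) (iso_bij h)).

(* A subgroup of a loop is a subloop whose induced multiplication is
   associative. *)
Record subgroup (L : loopType) := Subgroup {
  sg_set : set L;
  sg1 : sg_set 1;
  sgM : forall x y, sg_set x -> sg_set y -> sg_set (x * y);
  sg_ldiv : forall x y, sg_set x -> sg_set y -> sg_set (ldiv x y);
  sg_rdiv : forall x y, sg_set x -> sg_set y -> sg_set (rdiv x y);
  sgA : forall x y z, sg_set x -> sg_set y -> sg_set z ->
    x * (y * z) = x * y * z
}.

Definition sg_type (L : loopType) (G : subgroup L) := {x : L | x \in sg_set G}.

Section SubgroupGroup.
Context (L : loopType) (G : subgroup L).
Implicit Types x y z : sg_type G.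

Lemma sg_valP x : sg_set G (sval x).
Proof. by apply: set_mem; case: x. Qed.

Lemma sg_inj : injective (fun x => sval x).
Proof. exact: val_inj. Qed.

Definition sg_one : sg_type G := exist _ 1 (mem_set (sg1 G)).
Definition sg_mul x y : sg_type G :=
  exist _ (sval x * sval y) (mem_set (sgM (sg_valP x) (sg_valP y))).
Definition sg_inv x : sg_type G :=
  exist _ (ldiv (sval x) 1) (mem_set (sg_ldiv (sg_valP x) (sg1 G))).

Lemma sg_mulA : associative sg_mul.
Proof.
by move=> x y z; apply: sg_inj => /=; apply: (@sgA _ G); apply: sg_valP.
Qed.

Lemma sg_mul1 : left_id sg_one sg_mul.
Proof. by move=> x; apply: sg_inj; rewrite /= loop_mul1. Qed.

Lemma sg_mulr1 : right_id sg_one sg_mul.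
Proof. by move=> x; apply: sg_inj; rewrite /= loop_mulr1. Qed.

Lemma sg_mulV : right_inverse sg_one sg_inv sg_mul.
Proof. by move=> x; apply: sg_inj; rewrite /= mul_ldiv. Qed.

Lemma sg_mulVl : left_inverse sg_one sg_inv sg_mul.
Proof.
move=> x; rewrite -[LHS]sg_mulr1 -{1}(sg_mulV (sg_inv x)) sg_mulA.
by rewrite -(sg_mulA _ x) sg_mulV sg_mulr1 sg_mulV.
Qed.

(* [groupType] demands a choice structure on the carrier, which is supplied
   classically so as not to constrain L. *)
HB.instance Definition _ := gen_eqMixin (sg_type G).
HB.instance Definition _ := gen_choiceMixin (sg_type G).
HB.instance Definition _ := isGroup.Build (sg_type G)
  sg_mulA sg_mul1 sg_mulr1 sg_mulVl sg_mulV.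

End SubgroupGroup.

Coercion sg_group (L : loopType) (G : subgroup L) : groupType := sg_type G.

Section Nuclei.
Context (L : loopType).

Definition middle_nucleus : set L :=
  [set u | forall x y : L, (x * u) * y = x * (u * y)].

Definition right_nucleus : set L :=
  [set u | forall x y : L, (x * y) * u = x * (y * u)].

Definition middle_nuclear (G : subgroup L) := sg_set G `<=` middle_nucleus.

Definition right_nuclear (G : subgroup L) := sg_set G `<=` right_nucleus.

End Nuclei.

Definition lcoset (L : loopType) (x : L) (A : set L) : set L :=
  [set x * a | a in A].

Definition rcoset (L : loopType) (A : set L) (x : L) : set L :=
  [set a * x | a in A].

(* Bruck's definition; the subloops satisfying it are the kernels of the loop
   homomorphisms defined on L. *)
Definition normal (L : loopType) (G : subgroup L) : Prop :=
  forall x y : L,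
  [/\ lcoset x (sg_set G) = rcoset (sg_set G) x,
      lcoset x (lcoset y (sg_set G)) = lcoset (x * y) (sg_set G) &
      rcoset (rcoset (sg_set G) x) y = rcoset (sg_set G) (x * y)].

Record quotient (L : loopType) (G : subgroup L) (nG : normal G) := Quotient {
  coset_set :> set L;
  coset_ex : exists x, coset_set = lcoset x (sg_set G)
}.

Section QuotientLoop.
Context (L : loopType) (G : subgroup L) (nG : normal G).
Implicit Types (x y z : L) (A B C : quotient nG).

Lemma coset_inj A B : A = B :> set L -> A = B.
Proof.
by case: A B => [A pA] [B pB] /= E; case: _ / E pB => pB;
  rewrite (Prop_irrelevance pA pB).
Qed.

Lemma lcosetP x z : lcoset x (sg_set G) z <-> sg_set G (ldiv x z).
Proof.
split; first by case=> a Ga <-; rewrite ldiv_mul.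
by move=> Gz; exists (ldiv x z); rewrite ?mul_ldiv.
Qed.

Lemma lcoset_refl x : lcoset x (sg_set G) x.
Proof. by exists 1; [exact: sg1 | exact: loop_mulr1]. Qed.

Lemma lcoset_1 : lcoset 1 (sg_set G) = sg_set G.
Proof.
apply/seteqP; split=> [_ [a Ga <-]|a Ga]; first by rewrite loop_mul1.
by exists a; rewrite ?loop_mul1.
Qed.

Lemma lcoset_sg x : sg_set G x -> lcoset x (sg_set G) = sg_set G.
Proof.
move=> Gx; apply/seteqP; split=> [_ [a Ga <-]|a Ga]; first exact: sgM.
by exists (ldiv x a); [exact: sg_ldiv | rewrite mul_ldiv].
Qed.

Lemma lcoset_eq x z : lcoset x (sg_set G) z <-> lcoset z (sg_set G) = lcoset x (sg_set G).
Proof.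
split; last by move<-; exact: lcoset_refl.
case=> a Ga <-; have [_ <- _] := nG x a.
by rewrite (lcoset_sg Ga).
Qed.

Lemma lcosetM x y x' y' :
  lcoset x (sg_set G) x' -> lcoset y (sg_set G) y' -> lcoset (x * y) (sg_set G) (x' * y').
Proof.
move=> Hx /lcoset_eq Hy.
have [E1 _ _] := nG x y; have [_ _ E2] := nG x y; have [E3 _ _] := nG (x * y) 1.
have Hl : lcoset (x * y) (sg_set G) (x' * y).
  by rewrite E3 -E2; exists x' => //; rewrite -E1.
have [_ E4 _] := nG x' y; have [_ E5 _] := nG x' y'.
by move/lcoset_eq: Hl => <-; apply/lcoset_eq; rewrite -E4 -E5 Hy.
Qed.

Lemma lcoset_cancell x y z : lcoset (x * y) (sg_set G) (x * z) -> lcoset y (sg_set G) z.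
Proof. by have [_ <- _] := nG x y; case=> u Hu /loop_mulI <-. Qed.

Lemma lcoset_cancelr x y z : lcoset (x * y) (sg_set G) (z * y) -> lcoset x (sg_set G) z.
Proof.
have [E1 _ E2] := nG x y; have [-> _ _] := nG (x * y) 1.
by rewrite -E2 E1; case=> u Hu /loop_mulIr <-.
Qed.

Definition set_op (op : L -> L -> L) (X Y : set L) : set L :=
  [set op x y | x in X & y in Y].

Lemma set_mulE x y :
  set_op mul (lcoset x (sg_set G)) (lcoset y (sg_set G)) = lcoset (x * y) (sg_set G).
Proof.
apply/seteqP; split=> [_ [x' Hx [y' Hy <-]]|z]; first exact: lcosetM.
have [_ <- _] := nG x y; case=> u Hu <-.
by exists x; [exact: lcoset_refl | exists u].
Qed.

Lemma set_ldivE x y :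
  set_op ldiv (lcoset x (sg_set G)) (lcoset y (sg_set G)) = lcoset (ldiv x y) (sg_set G).
Proof.
apply/seteqP; split=> [_ [x' Hx [y' Hy <-]]|z Hz].
  apply: (@lcoset_cancell x); rewrite mul_ldiv.
  have /lcoset_eq <- := Hy; apply/lcoset_eq; rewrite -{2}(mul_ldiv x' y').
  by apply/esym/lcoset_eq/lcosetM => //; exact: lcoset_refl.
exists x; first exact: lcoset_refl.
exists (x * z); last exact: ldiv_mul.
by rewrite -(mul_ldiv x y); apply: lcosetM => //; exact: lcoset_refl.
Qed.

Lemma set_rdivE x y :
  set_op rdiv (lcoset x (sg_set G)) (lcoset y (sg_set G)) = lcoset (rdiv x y) (sg_set G).
Proof.
apply/seteqP; split=> [_ [x' Hx [y' Hy <-]]|z Hz].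
  apply: (@lcoset_cancelr _ y); rewrite rdiv_mul.
  have /lcoset_eq <- := Hx; apply/lcoset_eq; rewrite -{2}(rdiv_mul y' x').
  by apply/esym/lcoset_eq/lcosetM => //; exact: lcoset_refl.
exists (z * y).
  by rewrite -{1}(rdiv_mul y x); apply: lcosetM => //; exact: lcoset_refl.
by exists y; [exact: lcoset_refl | exact: mul_rdiv].
Qed.

Lemma quo_mul_ex A B : exists x, set_op mul A B = lcoset x (sg_set G).
Proof.
case: A B => [A [x Ex]] [B [y Ey]] /=; rewrite Ex Ey; exists (x * y); exact: set_mulE.
Qed.

Lemma quo_ldiv_ex A B : exists x, set_op ldiv A B = lcoset x (sg_set G).
Proof.
case: A B => [A [x Ex]] [B [y Ey]] /=; rewrite Ex Ey; exists (ldiv x y); exact: set_ldivE.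
Qed.

Lemma quo_rdiv_ex A B : exists x, set_op rdiv A B = lcoset x (sg_set G).
Proof.
case: A B => [A [x Ex]] [B [y Ey]] /=; rewrite Ex Ey; exists (rdiv x y); exact: set_rdivE.
Qed.

Lemma quo_one_ex : exists x, sg_set G = lcoset x (sg_set G).
Proof. by exists 1; rewrite lcoset_1. Qed.

Definition quo_one : quotient nG := Quotient nG quo_one_ex.
Definition quo_mul A B : quotient nG := Quotient nG (quo_mul_ex A B).
Definition quo_ldiv A B : quotient nG := Quotient nG (quo_ldiv_ex A B).
Definition quo_rdiv A B : quotient nG := Quotient nG (quo_rdiv_ex A B).

Lemma quo_mul1 : left_id quo_one quo_mul.
Proof.
case=> [A [x Ex]]; apply: coset_inj => /=.
by rewrite Ex -{1}lcoset_1 set_mulE loop_mul1.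
Qed.

Lemma quo_mulr1 : right_id quo_one quo_mul.
Proof.
case=> [A [x Ex]]; apply: coset_inj => /=.
by rewrite Ex -{2}lcoset_1 set_mulE loop_mulr1.
Qed.

Lemma quo_mul_ldiv A B : quo_mul A (quo_ldiv A B) = B.
Proof.
case: A B => [A [x Ex]] [B [y Ey]]; apply: coset_inj => /=.
by rewrite Ex Ey set_ldivE set_mulE mul_ldiv.
Qed.

Lemma quo_ldiv_mul A B : quo_ldiv A (quo_mul A B) = B.
Proof.
case: A B => [A [x Ex]] [B [y Ey]]; apply: coset_inj => /=.
by rewrite Ex Ey set_mulE set_ldivE ldiv_mul.
Qed.

Lemma quo_rdiv_mul A B : quo_mul (quo_rdiv B A) A = B.
Proof.
case: A B => [A [x Ex]] [B [y Ey]]; apply: coset_inj => /=.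
by rewrite Ex Ey set_rdivE set_mulE rdiv_mul.
Qed.

Lemma quo_mul_rdiv A B : quo_rdiv (quo_mul B A) A = B.
Proof.
case: A B => [A [x Ex]] [B [y Ey]]; apply: coset_inj => /=.
by rewrite Ex Ey set_mulE set_rdivE mul_rdiv.
Qed.

HB.instance Definition _ := hasMul.Build (quotient nG) quo_mul.
HB.instance Definition _ := hasOne.Build (quotient nG) quo_one.
HB.instance Definition _ := BaseUMagma_isLoop.Build (quotient nG)
  quo_mul1 quo_mulr1 quo_mul_ldiv quo_ldiv_mul quo_rdiv_mul quo_mul_rdiv.

End QuotientLoop.

Definition schreier_data (K : loopType) (G : groupType)
    (f : K -> K -> G) (Theta : K -> aut G) : Prop :=
  [/\ forall s, f s 1 = 1, forall s, f 1 s = 1 & Theta 1 =1 id].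

Definition schreier_ext (K : loopType) (G : groupType)
    (f : K -> K -> G) (Theta : K -> aut G) (D : schreier_data f Theta) : Type :=
  K * G.

Section SchreierLoop.
Context (K : loopType) (G : groupType) (f : K -> K -> G) (Theta : K -> aut G).
Context (D : schreier_data f Theta).

Definition ext_mul (x y : schreier_ext D) : schreier_ext D :=
  (x.1 * y.1, f x.1 y.1 * Theta y.1 x.2 * y.2).

Definition ext_one : schreier_ext D := (1, 1).

Lemma aut_inv_ex (th : aut G) : exists g : G -> G, cancel th g /\ cancel g th.
Proof. by have [g] := iso_bij th; exists g. Qed.

Definition aut_inv (th : aut G) : G -> G := projT1 (cid (aut_inv_ex th)).

Lemma aut_invK (th : aut G) : cancel th (aut_inv th).
Proof. by rewrite /aut_inv; case: cid => g []. Qed.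

Lemma aut_Kinv (th : aut G) : cancel (aut_inv th) th.
Proof. by rewrite /aut_inv; case: cid => g []. Qed.

Definition ext_ldiv (x z : schreier_ext D) : schreier_ext D :=
  let t := ldiv x.1 z.1 in (t, (f x.1 t * Theta t x.2)^-1 * z.2).

Definition ext_rdiv (z y : schreier_ext D) : schreier_ext D :=
  let s := rdiv z.1 y.1 in
  (s, aut_inv (Theta y.1) ((f s y.1)^-1 * (z.2 * y.2^-1))).

Lemma iso1 (th : aut G) : th 1 = 1.
Proof. by apply: (@mulgI _ (th 1)); rewrite -isoM !mulg1. Qed.

Lemma ext_mul1 : left_id ext_one ext_mul.
Proof.
have [_ f1 _] := D; case=> s t.
by rewrite /ext_mul /= loop_mul1 f1 iso1 !mul1g.
Qed.

Lemma ext_mulr1 : right_id ext_one ext_mul.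
Proof.
have [f1 _ T1] := D; case=> s t.
by rewrite /ext_mul /= loop_mulr1 f1 T1 mul1g mulg1.
Qed.

Lemma ext_mul_ldiv x z : ext_mul x (ext_ldiv x z) = z.
Proof. by case: z => z1 z2; rewrite /ext_mul /= mul_ldiv mulVKg. Qed.

Lemma ext_ldiv_mul x y : ext_ldiv x (ext_mul x y) = y.
Proof. by case: y => y1 y2; rewrite /ext_ldiv /= ldiv_mul mulKg. Qed.

Lemma ext_rdiv_mul y z : ext_mul (ext_rdiv z y) y = z.
Proof.
by case: z => z1 z2; rewrite /ext_mul /= rdiv_mul aut_Kinv mulVKg mulgVK.
Qed.

Lemma ext_mul_rdiv y x : ext_rdiv (ext_mul x y) y = x.
Proof.
by case: x => x1 x2; rewrite /ext_rdiv /= mul_rdiv mulgK mulKg aut_invK.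
Qed.

HB.instance Definition _ := hasMul.Build (schreier_ext D) ext_mul.
HB.instance Definition _ := hasOne.Build (schreier_ext D) ext_one.
HB.instance Definition _ := BaseUMagma_isLoop.Build (schreier_ext D)
  ext_mul1 ext_mulr1 ext_mul_ldiv ext_ldiv_mul ext_rdiv_mul ext_mul_rdiv.

End SchreierLoop.

(* The normalisation of f and Theta is part of the assertion. *)
Definition schreier_decomposition (L : loopType) (G : subgroup L)
    (nG : normal G) (K : loopType) (f : K -> K -> G) (Theta : K -> aut G)
    (kappa : iso K (quotient nG)) : Prop :=
  exists (D : schreier_data f Theta) (F : iso (schreier_ext D) L),
    (forall t : G, F (1, t) = sval t) /\
    (forall s : K, lcoset (F (s, 1)) (sg_set G) = kappa s).

(* Main.v *)
(* Precomposing F with (sigma, t) |-> (mu sigma, t), an isomorphism from the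
   extension by f', Theta' onto the extension by f, Theta, gives the required
   isomorphism onto L. *)
Require Import Defs.
From mathcomp Require Import all_boot.

(** Once [mu] is applied to the [K]-coordinates, the product formulas of the two extensions
    coincide, so [ext_reparam] is an isomorphism. As [mu 1 = 1] ([loop_iso1]), the normalisation
    carries over and each [(1, t)] is fixed. *)

Lemma loop_iso1 (M N : loopType) (h : iso M N) : h 1%g = 1%g.
(* Cancel [h 1] on the left in [h 1 * h 1 = h 1 * 1]. *)
Proof. by apply: (@loop_mulI _ (h 1%g)); rewrite -isoM !loop_mulr1. Qed.

Section Reparametrization.
Context (K : loopType) (G : groupType).
Context (f f' : K -> K -> G) (Theta Theta' : K -> aut G) (mu : aut K).
Hypothesis hTheta' : forall tau : K, Theta' tau = Theta (mu tau).
Hypothesis hf' :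
  forall sigma tau : K, f' sigma tau = f (mu sigma) (mu tau).

Lemma schreier_data_reparam : schreier_data f Theta -> schreier_data f' Theta'.
Proof.
case=> f1 f1l T1; split=> [s|s|]; first by rewrite hf' loop_iso1 f1.
- by rewrite hf' loop_iso1 f1l.
- by rewrite hTheta' loop_iso1.
Qed.

Context (D : schreier_data f Theta) (D' : schreier_data f' Theta').

Definition ext_reparam (x : schreier_ext D') : schreier_ext D := (mu x.1, x.2).

Lemma ext_reparamM : {morph ext_reparam : x y / (x * y)%g}.
Proof.
case=> s a [t b].
(* Unfolds both extension products into coordinates. *)
change ((mu (s * t), f' s t * Theta' t a * b)
        = (mu s * mu t, f (mu s) (mu t) * Theta (mu t) a * b))%g.
by rewrite isoM hf' hTheta'.
Qed.

Lemma ext_reparam_bij : bijective ext_reparam.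
Proof.
have [nu muK nuK] := iso_bij mu.
by exists (fun x => (nu x.1, x.2)) => -[s a]; rewrite /ext_reparam /= ?muK ?nuK.
Qed.

Definition ext_reparam_iso : iso (schreier_ext D') (schreier_ext D) :=
  Iso ext_reparamM ext_reparam_bij.

End Reparametrization.

Theorem proposition50 (L : loopType) (G : subgroup L)
    (hmiddle : middle_nuclear G) (hright : right_nuclear G) (nG : normal G)
    (K : loopType) (f : K -> K -> G) (Theta : K -> aut G)
    (kappa : iso K (quotient nG))
    (hdec : schreier_decomposition f Theta kappa)
    (mu : aut K)
    (Theta' : K -> aut G) (f' : K -> K -> G)
    (hTheta' : forall tau : K, Theta' tau = Theta (mu tau))
    (hf' : forall sigma tau : K, f' sigma tau = f (mu sigma) (mu tau)) :
  schreier_decomposition f' Theta' (iso_comp kappa mu).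
Proof.
case: hdec => D [F [F1 Fkappa]].
have D' := schreier_data_reparam _ _ _ _ _ _ _ hTheta' hf' D.
exists D', (iso_comp F (ext_reparam_iso _ _ _ _ _ _ _ hTheta' hf' D D')).
(* The coset condition at [s] is, by computation, the one for [F] at [mu s]. *)
split=> [t|s] /=; last exact: Fkappa.
by rewrite /ext_reparam loop_iso1 F1.
Qed.
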